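(* Let $w\in S_n$. If $w$ is multiplicity-free, then the Schubert polynomial $\mathfrak{S}_w$ is zero-one (all its coefficients are $0$ or $1$).
   Context: Schubert polynomials: $\mathfrak{S}_{w_0}=x_1^{n-1}\cdots x_{n-1}$ for $w_0=n\cdots 1$, and $\mathfrak{S}_w=\partial_i\mathfrak{S}_{ws_i}$ when $w_i<w_{i+1}$, with $\partial_if=(f-s_if)/(x_i-x_{i+1})$. The Rothe diagram is $D(w)=\{(i,j)\in[n]^2: i<w^{-1}(j),\ j<w_i\}$ ($i$ = row, $j$ = column); a diagram is regarded as the sequence of its columns $C_1,\dots,C_n\subseteq[n]$. Write $[j]=\{1,\dots,j\}$. A missing tooth of a column $C$ is an integer $i\ge1$ with $i\notin C$, $i+1\in C$. Orthodontia: replace every column of $D(w)$ equal to some $[j]$ by an empty column, obtaining $E_0$. For $r\ge1$, while $E_{r-1}$ has a nonempty column, let $i_r$ be the smallest missing tooth of the leftmost nonempty column of $E_{r-1}$, swap rows $i_r$ and $i_r+1$ of $E_{r-1}$ to get $O_r$, and let $E_r$ be $O_r$ with all columns equal to $[i_r]$ replaced by empty columns (column indices are kept throughout, as in $D(w)$). The process stops at some $l$, giving $\bm{i}=(i_1,\dots,i_l)$. The orthodontic impact function $\mathcal{I}_w:[l]\to 2^{[n]}$ is $\mathcal{I}_w(j)=\{c\in[n]: (i_j+1,c)\in E_{j-1}\}$. The permutation $w$ is multiplicity-free if for all $r\ne s$ in $[l]$ with $i_r=i_s$ there is $c\in[n]$ with $\mathcal{I}_w(r)=\mathcal{I}_w(s)=\{c\}$.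 *)

(* Defs.v *)
From mathcomp Require Import all_boot all_algebra all_fingroup.
From mathcomp Require Import mpoly.
From Stdlib Require Import ClassicalEpsilon.

Set Implicit Arguments.
Unset Strict Implicit.
Unset Printing Implicit Defensive.

Import GRing.Theory.
Local Open Scope ring_scope.

(* Conventions: rows, columns, positions and variables are 0-based:
   position k : 'I_n corresponds to k+1 in the paper, variable 'X_k is x_{k+1}. *)

Section Schubert.
Variable n : nat.

(* the successor of i in 'I_n (only used when i.+1 < n) *)
Definition nxt (i : 'I_n) : 'I_n := insubd i i.+1.

Definition sxp (i : 'I_n) : 'S_n := tperm i (nxt i).

(* divided difference ∂_i f = (f - s_i f)/(x_i - x_{i+1}):
   the (unique) g with (x_i - x_{i+1}) g = f - s_i f *)
Definition divdiff (i : 'I_n) (f : {mpoly int[n]}) : {mpoly int[n]} :=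
  epsilon (inhabits 0)
    (fun g : {mpoly int[n]} => ('X_i - 'X_(nxt i)) * g = f - msym (sxp i) f).

Definition schub_w0 : {mpoly int[n]} := \prod_(i < n) 'X_i ^+ (n.-1 - i).

Definition ascent (w : 'S_n) (i : 'I_n) : bool := ((i.+1 < n) && (w i < w (nxt i)))%N.

(* S_w = ∂_i S_{w s_i} for the smallest ascent i of w; S_{w0} for w = w0
   (the unique permutation without ascents).  Note: in mathcomp,
   (s * w) x = w (s x), so w s_i is (sxp i * w). *)
Fixpoint schub_rec (fuel : nat) (w : 'S_n) : {mpoly int[n]} :=
  match fuel with
  | 0 => 0
  | f.+1 =>
      match ohead [seq i <- enum 'I_n | ascent w i] with
      | None => schub_w0
      | Some i => divdiff i (schub_rec f (sxp i * w))
      end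
  end.

(* n*n exceeds the length of w0, so the fuel is never exhausted *)
Definition schubert (w : 'S_n) : {mpoly int[n]} := schub_rec (n * n).+1 w.

Definition zero_one (p : {mpoly int[n]}) : Prop :=
  forall m, p@_m = 0 \/ p@_m = 1.

(* a diagram: column c |-> set of rows of the cells in column c *)
Definition diagram := {ffun 'I_n -> {set 'I_n}}.

Definition rothe (w : 'S_n) : diagram :=
  [ffun j : 'I_n => [set i : 'I_n | ((i < (w^-1)%g j) && (j < w i))%N]].

Definition initcol (j : nat) : {set 'I_n} := [set r : 'I_n | (r < j)%N].

Definition inC (C : {set 'I_n}) (t : nat) : bool := [exists r in C, val r == t].

Definition ortho_E0 (D : diagram) : diagram :=
  [ffun c => if [exists j : 'I_n.+1, D c == initcol j] then set0 else D c].

Definition tswap (t r : nat) : nat :=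
  if r == t then t.+1 else if r == t.+1 then t else r.

(* one orthodontic step.  A missing tooth i (paper, 1-based) of C means the
   0-based rows t = i-1 not in C and t+1 in C; we return i = t+1. *)
Definition ortho_step (D : diagram) : option (nat * {set 'I_n} * diagram) :=
  match ohead [seq c <- enum 'I_n | D c != set0] with
  | None => None
  | Some c =>
      match ohead [seq t <- iota 0 n | ~~ inC (D c) t && inC (D c) t.+1] with
      | None => None
      | Some t =>
          let impact := [set c' : 'I_n | inC (D c') t.+1] in
          let O := [ffun c' : 'I_n => [set r : 'I_n | inC (D c') (tswap t r)]] in
          let E := [ffun c' : 'I_n => if O c' == initcol t.+1 then set0 else O c'] in
          Some (t.+1, impact, E)
      end
  end.

Fixpoint ortho_run (fuel : nat) (D : diagram) : seq (nat * {set 'I_n}) * diagram :=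
  match fuel with
  | 0 => ([::], D)
  | f.+1 =>
      match ortho_step D with
      | None => ([::], D)
      | Some (i, imp, D') => let: (s, Df) := ortho_run f D' in ((i, imp) :: s, Df)
      end
  end.

Definition all_empty (D : diagram) : bool := [forall c, D c == set0].

Definition mf_condition (s : seq (nat * {set 'I_n})) : Prop :=
  forall a b, (a < size s)%N -> (b < size s)%N -> a <> b ->
    (nth (0%N, set0) s a).1 = (nth (0%N, set0) s b).1 ->
    exists c : 'I_n, (nth (0%N, set0) s a).2 = [set c] /\
                     (nth (0%N, set0) s b).2 = [set c].

(* w is multiplicity-free: the orthodontia of D(w) terminates (all columns
   empty) with data (i, I_w) satisfying the multiplicity-free condition *)
Definition multiplicity_free (w : 'S_n) : Prop :=
  exists fuel, let: (s, Df) := ortho_run fuel (ortho_E0 (rothe w)) in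
               all_empty Df /\ mf_condition s.

End Schubert.

(* Main.v *)
(** Magyar's orthodontia formula writes S_w as a monomial times
    π_{i_1}(ω_{i_1}^{m_1} π_{i_2}(ω_{i_2}^{m_2} ... )), where π_i f = ∂_i(x_i f),
    ω_i = x_1...x_i and m_r counts the columns removed at step r. It is proved by
    induction on the orthodontia, following S_w = ∂_i S_{w s_i} along ascents.

    For a multiplicity-free w, read the formula from the inside out. If the tooth
    i of a step does not recur later, then inside π_i the total degree in
    x_1..x_i is constant and the exponent of x_i dominates that of x_{i+1}, so
    the i-strings of distinct monomials are disjoint and π_i preserves
    zero-oneness. If i recurs, all steps with tooth i meet only the leftmost
    column c; the other columns then lie in the full top rows of c, so inside π_i
    the exponents of x_i and x_{i+1} are at most 1, and again π_i preserves
    zero-oneness. *)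

Require Import Defs.
From mathcomp Require Import all_boot all_algebra all_fingroup.
From mathcomp Require Import mpoly.
From mathcomp Require Import zify ring.
From Stdlib Require Import ClassicalEpsilon.

Set Implicit Arguments.
Unset Strict Implicit.
Unset Printing Implicit Defensive.

Import GRing.Theory.
Local Open Scope ring_scope.

(** * Divided differences *)

(** With [S] and [T] acting as adjacent transpositions, clearing denominators turns the triple
    divided difference [d] into the alternating sum over the symmetric group S_3. *)
Lemma mul_braid (R : comNzRingType) (S T : {rmorphism R -> R}) (x y z f h g d : R) :
  S x = y -> S y = x -> S z = z -> T x = x -> T y = z -> T z = y ->
  (x - y) * h = f - S f -> S h = h -> (y - z) * g = h - T h -> (x - y) * d = g - S g ->
  (y - z) * (x - z) * (x - y) * d =
    f - S f - T f + T (S f) + S (T f) - S (T (S f)).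
Proof.
move=> Sx Sy Sz Tx Ty Tz E Sh E2 E0.
have E3 : (x - z) * S g = h - S (T h) by rewrite -{1}Sh -rmorphB -E2 rmorphM rmorphB Sy Sz.
have E4 : (x - z) * T h = T f - T (S f) by rewrite -rmorphB -E rmorphM rmorphB Tx Ty.
have E5 : (y - z) * S (T h) = S (T f) - S (T (S f)).
  by rewrite -rmorphB -E4 rmorphM rmorphB Sx Sz.
have -> : (y - z) * (x - z) * (x - y) * d = (y - z) * (x - z) * ((x - y) * d) by ring.
rewrite E0.
have -> : (y - z) * (x - z) * (g - S g) =
  (x - z) * ((y - z) * g) - (y - z) * ((x - z) * S g) by ring.
rewrite E2 E3.
have -> : (x - z) * (h - T h) - (y - z) * (h - S (T h)) =
  (x - y) * h - (x - z) * T h + (y - z) * S (T h) by ring.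
by rewrite E E4 E5; ring.
Qed.

Section AbstractDividedDifference.
Variables (R : idomainType) (S T : {rmorphism R -> R}).

Lemma braid_unique (x y z f h g d h' g' d' : R) :
  S x = y -> S y = x -> S z = z -> T x = x -> T y = z -> T z = y ->
  x - y != 0 -> x - z != 0 -> y - z != 0 -> S (T (S f)) = T (S (T f)) ->
  (x - y) * h = f - S f -> S h = h -> (y - z) * g = h - T h -> (x - y) * d = g - S g ->
  (y - z) * h' = f - T f -> T h' = h' -> (x - y) * g' = h' - S h' ->
    (y - z) * d' = g' - T g' ->
  d = d'.
Proof.
move=> Sx Sy Sz Tx Ty Tz n1 n2 n3 bf E Sh E2 E0 E' Th E2' E0'.
apply: (mulfI (mulf_neq0 (mulf_neq0 n3 n2) n1)).
rewrite (mul_braid Sx Sy Sz Tx Ty Tz E Sh E2 E0) bf.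
have flip (a b : R) : - b - - a = a - b by ring.
(* Passing to [-z], [-y], [-x] exchanges the roles of [S] and [T] and of [x - y] and [y - z], so the
   same expansion serves the other word. *)
have := @mul_braid R T S (- z) (- y) (- x) f h' g' d'.
rewrite !rmorphN Sx Sy Sz Tx Ty Tz !flip => /(_ erefl erefl erefl erefl erefl erefl E' Th E2' E0') M.
have -> : (y - z) * (x - z) * (x - y) * d' = (x - y) * (x - z) * (y - z) * d' by ring.
by rewrite M; ring.
Qed.

Lemma comm_unique (a b f h h' d d' : R) :
  S b = b -> T a = a -> a != 0 -> b != 0 -> S (T f) = T (S f) ->
  b * h = f - T f -> a * d = h - S h -> a * h' = f - S f -> b * d' = h' - T h' -> d = d'.
Proof.
move=> Sb Ta na nb c E E0 E' E0'; apply: (mulfI (mulf_neq0 na nb)).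
have E1 : b * S h = S f - S (T f) by rewrite -rmorphB -E rmorphM Sb.
have E1' : a * T h' = T f - T (S f) by rewrite -rmorphB -E' rmorphM Ta.
have -> : a * b * d = b * (a * d) by ring.
have -> : a * b * d' = a * (b * d') by ring.
by rewrite E0 E0' !mulrBr E E' E1 E1' c; ring.
Qed.

End AbstractDividedDifference.

Section DividedDifference.
Variable n : nat.
Implicit Types (i j k : 'I_n) (f g h p q : {mpoly int[n]}).

Notation sy i := (msym (sxp i)).

Lemma val_nxt i : (i.+1 < n)%N -> nxt i = i.+1 :> nat.
Proof. by move=> hi; rewrite /nxt val_insubd hi. Qed.

Lemma nxt_neq i : (i.+1 < n)%N -> i != nxt i.
Proof. by move=> hi; rewrite -val_eqE /= val_nxt //; lia. Qed.

Lemma msymXi (s : 'S_n) i : msym s ('X_i : {mpoly int[n]}) = 'X_(s i).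
Proof.
rewrite msymX; congr 'X_[_]; apply/mnmP=> j.
by rewrite mnmE !mnm1E; congr (nat_of_bool _); rewrite -(inj_eq (@perm_inj _ s)) permKV.
Qed.

Lemma syK i : involutive (sy i : {mpoly int[n]} -> _).
Proof. by move=> f; rewrite -msymMm /sxp tperm2 msym1m. Qed.

Lemma sxp_l i : sxp i i = nxt i. Proof. exact: tpermL. Qed.
Lemma sxp_r i : sxp i (nxt i) = i. Proof. exact: tpermR. Qed.

Lemma subX_neq0 i j : i != j -> 'X_i - 'X_j != 0 :> {mpoly int[n]}.
Proof.
move=> nij; apply/eqP=> /(congr1 (mcoeff U_(i)%MM)).
rewrite mcoeffB mcoeff0 !mcoeffX eqxx; case: eqP => [/(congr1 (fun m : 'X_{1..n} => m i))|//].
by rewrite !mnm1E eqxx eq_sym (negbTE nij).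
Qed.

(** Divisibility of f - s_i f is stable under products by the twisted Leibniz rule, so variables
    suffice; linearity does the rest. This makes the [epsilon] in [divdiff] meaningful. *)
Lemma divdiff_ex i f :
  exists g : {mpoly int[n]}, ('X_i - 'X_(nxt i)) * g = f - sy i f.
Proof.
pose P f := exists g : {mpoly int[n]}, ('X_i - 'X_(nxt i)) * g = f - sy i f.
have PM f1 f2 : P f1 -> P f2 -> P (f1 * f2).
  move=> [g1 e1] [g2 e2]; exists (g1 * f2 + sy i f1 * g2).
  rewrite mulrDr mulrA e1 mulrCA e2 msymM; ring.
have P1 : P 1 by exists 0; rewrite msym1 subrr mulr0.
have PX j : P 'X_j.
  rewrite /P msymXi /sxp; case: tpermP => [->|->|_ _]; first by exists 1; rewrite mulr1.
    by exists (-1); ring.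
  by exists 0; rewrite mulr0 subrr.
have PE f1 a : P f1 -> P (f1 ^+ a).
  by move=> P1f; elim: a => [|a IH]; rewrite ?expr0 // exprS; exact: (PM _ _ P1f IH).
have Pm m : P 'X_[m].
  by rewrite mpolyXE_id; elim/big_rec: _ => // j x _ Px; exact: (PM _ _ (PE _ _ (PX j)) Px).
elim/mpolyind: f => [|c m p _ _ [g e]]; first by exists 0; rewrite msym0 subrr mulr0.
have [g1 e1] := Pm m; exists (c *: g1 + g).
by rewrite mulrDr -scalerAr e1 e msymD msymZ scalerBr; ring.
Qed.

Lemma divdiffE i f : ('X_i - 'X_(nxt i)) * divdiff i f = f - sy i f.
Proof. exact: (epsilon_spec _ _ (divdiff_ex i f)). Qed.

Section Fixed.
Variables (i : 'I_n) (hi : (i.+1 < n)%N).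

Let nz : 'X_i - 'X_(nxt i) != 0 :> {mpoly int[n]}.
Proof. exact: subX_neq0 (nxt_neq hi). Qed.

Lemma divdiff_unique f g : ('X_i - 'X_(nxt i)) * g = f - sy i f -> divdiff i f = g.
Proof. by rewrite -divdiffE => /(mulfI nz). Qed.

Lemma divdiffD f g : divdiff i (f + g) = divdiff i f + divdiff i g.
Proof. by apply: divdiff_unique; rewrite mulrDr !divdiffE msymD; ring. Qed.

Lemma divdiffZ c f : divdiff i (c *: f) = c *: divdiff i f.
Proof. by apply: divdiff_unique; rewrite -scalerAr divdiffE msymZ scalerBr. Qed.

Lemma sy_divdiff f : sy i (divdiff i f) = divdiff i f.
Proof.
apply/esym/divdiff_unique/(inj_msym (sxp i)).
rewrite msymM !msymB !msymXi syK sxp_l sxp_r.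
by rewrite syK -[LHS]opprK -mulNr opprB divdiffE opprB.
Qed.

Lemma divdiff_sym f : sy i f = f -> divdiff i f = 0.
Proof. by move=> e; apply: divdiff_unique; rewrite e mulr0 subrr. Qed.

Lemma divdiffMl f g : sy i f = f -> divdiff i (f * g) = f * divdiff i g.
Proof. by move=> e; apply: divdiff_unique; rewrite mulrCA divdiffE msymM e mulrBr. Qed.

Lemma divdiffXM f : divdiff i ('X_i * f) = f + 'X_(nxt i) * divdiff i f.
Proof.
by apply: divdiff_unique; rewrite mulrDr mulrCA divdiffE msymM msymXi sxp_l; ring.
Qed.

Lemma divdiffXM_sym f : sy i f = f -> divdiff i ('X_i * f) = f.
Proof. by move=> e; rewrite divdiffXM divdiff_sym // mulr0 addr0. Qed.

End Fixed.

Lemma nxt_far i j : (i.+1 < n)%N -> (j.+1 < n)%N -> (i.+1 < j)%N ->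
  [/\ i != j, i != nxt j, nxt i != j & nxt i != nxt j].
Proof. by move=> hi hj hij; rewrite -!val_eqE /= !val_nxt //; split; lia. Qed.

Lemma sxp_far i j : (i.+1 < n)%N -> (j.+1 < n)%N -> (i.+1 < j)%N ->
  (sxp i * sxp j = sxp j * sxp i)%g.
Proof.
move=> hi hj hij; have [a b c d] := nxt_far hi hj hij.
by rewrite [RHS]conjgC tpermJ /sxp !tpermD.
Qed.

Lemma divdiff_comm i j f : (i.+1 < n)%N -> (j.+1 < n)%N -> (i.+1 < j)%N ->
  divdiff i (divdiff j f) = divdiff j (divdiff i f).
Proof.
move=> hi hj hij; have [a b c d] := nxt_far hi hj hij.
have s1 : sy i ('X_j - 'X_(nxt j) : {mpoly int[n]}) = 'X_j - 'X_(nxt j).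
  by rewrite msymB !msymXi /sxp !tpermD.
have s2 : sy j ('X_i - 'X_(nxt i) : {mpoly int[n]}) = 'X_i - 'X_(nxt i).
  by rewrite msymB !msymXi /sxp !tpermD // eq_sym.
have c' : sy i (sy j f) = sy j (sy i f) by rewrite -!msymMm (sxp_far hi hj hij).
exact: (comm_unique s1 s2 (subX_neq0 (nxt_neq hi)) (subX_neq0 (nxt_neq hj)) c'
  (divdiffE j f) (divdiffE i _) (divdiffE i f) (divdiffE j _)).
Qed.

Section Braid.
Variables (i : 'I_n) (hi : (i.+2 < n)%N).
Let j := nxt i.
Let k := nxt j.

Let hi' : (i.+1 < n)%N. Proof. exact: ltnW. Qed.
Let vj : j = i.+1 :> nat. Proof. by rewrite val_nxt. Qed.
Let hj : (j.+1 < n)%N. Proof. by rewrite vj. Qed.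
Let vk : k = i.+2 :> nat. Proof. by rewrite val_nxt // vj. Qed.
Let nij : i != j. Proof. exact: nxt_neq. Qed.
Let njk : j != k. Proof. exact: nxt_neq. Qed.
Let nik : i != k. Proof. by rewrite -val_eqE /= vk; lia. Qed.

Lemma nxt2_sym : sy j ('X_i : {mpoly int[n]}) = 'X_i.
Proof. by rewrite msymXi /sxp tpermD // eq_sym. Qed.

Lemma sxp_braid : (sxp i * sxp j * sxp i = sxp j * sxp i * sxp j)%g.
Proof.
have e1 : (sxp i * sxp j * sxp i)%g = tperm i k.
  rewrite -{1}[sxp i]tpermV -mulgA -[(_ * _)%g]/(sxp j ^ sxp i)%g /sxp tpermJ.
  by rewrite tpermR tpermD // eq_sym.
have e2 : (sxp j * sxp i * sxp j)%g = tperm i k.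
  rewrite -{1}[sxp j]tpermV -mulgA -[(_ * _)%g]/(sxp i ^ sxp j)%g /sxp tpermJ.
  by rewrite tpermL tpermD // eq_sym.
by rewrite e1 e2.
Qed.

Lemma divdiff_braid f : divdiff i (divdiff j (divdiff i f)) = divdiff j (divdiff i (divdiff j f)).
Proof.
have nz1 := subX_neq0 nij; have nz2 := subX_neq0 nik; have nz3 := subX_neq0 njk.
have Si : sy i ('X_i : {mpoly int[n]}) = 'X_j by rewrite msymXi sxp_l.
have Sj : sy i ('X_j : {mpoly int[n]}) = 'X_i by rewrite msymXi sxp_r.
have Sk : sy i ('X_k : {mpoly int[n]}) = 'X_k by rewrite msymXi /sxp tpermD.
have Tj : sy j ('X_j : {mpoly int[n]}) = 'X_k by rewrite msymXi sxp_l.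
have Tk : sy j ('X_k : {mpoly int[n]}) = 'X_j by rewrite msymXi sxp_r.
have Ti := nxt2_sym.
have bf : sy i (sy j (sy i f)) = sy j (sy i (sy j f)).
  by rewrite -!msymMm !mulgA sxp_braid.
exact: (braid_unique Si Sj Sk Ti Tj Tk nz1 nz2 nz3 bf
  (divdiffE i f) (sy_divdiff hi' f) (divdiffE j _) (divdiffE i _)
  (divdiffE j f) (sy_divdiff hj f) (divdiffE i _) (divdiffE j _)).
Qed.

End Braid.

Definition dem i f := divdiff i ('X_i * f).

(* With a = x_i, b = x_(i+1): b ∂_i(a f) = ∂_i(a^2 f) - a f, and ∂_(i+1) kills a f;
   writing a^2 f = ∂_(i+1)(a^2 b f) then exposes a braid. *)
Lemma dem_dem_sym i f : (i.+2 < n)%N -> sy (nxt i) f = f ->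
  sy i (dem (nxt i) (dem i f)) = dem (nxt i) (dem i f).
Proof.
move=> hi sf; have hi' : (i.+1 < n)%N by exact: ltnW.
have hj : ((nxt i).+1 < n)%N by rewrite val_nxt.
have sa : sy (nxt i) ('X_i * f) = 'X_i * f by rewrite msymM sf nxt2_sym.
have -> : dem (nxt i) (dem i f) =
    divdiff (nxt i) (divdiff i (divdiff (nxt i) ('X_(nxt i) * ('X_i * ('X_i * f))))).
  rewrite [X in divdiff i X]divdiffXM_sym //; last by rewrite msymM sa nxt2_sym.
  rewrite (divdiffXM hi') divdiffD // [X in _ = X + _]divdiff_sym ?add0r //.
by rewrite -divdiff_braid // sy_divdiff.
Qed.

End DividedDifference.

(** * Demazure operators on monomials *)

Section DemazureMonomials.
Variable n : nat.
Implicit Types (p q : {mpoly int[n]}) (m k : 'X_{1..n}).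
Variables (i : 'I_n) (hi : (i.+1 < n)%N).
Let j := nxt i.

Let nij : i != j. Proof. exact: nxt_neq. Qed.
Let nji : (j == i) = false. Proof. by rewrite eq_sym; apply/negbTE. Qed.

Definition setij m (a b : nat) : 'X_{1..n} :=
  [multinom if r == i then a else if r == nxt i then b else m r | r < n].

Lemma setij_l m a b : setij m a b i = a.
Proof. by rewrite mnmE eqxx. Qed.

Lemma setij_r m a b : setij m a b (nxt i) = b.
Proof. by rewrite mnmE nji eqxx. Qed.

Lemma setij_o m a b r : r != i -> r != nxt i -> setij m a b r = m r.
Proof. by move=> /negbTE ri /negbTE rj; rewrite mnmE ri rj. Qed.

Lemma setij_id m : setij m (m i) (m (nxt i)) = m.
Proof. by apply/mnmP=> r; rewrite mnmE; do 2?case: eqP => [->|_]. Qed.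

Lemma setijX m a b : 'X_[setij m a b] =
  'X_[setij m 0 0] * ('X_i ^+ a * 'X_(nxt i) ^+ b) :> {mpoly int[n]}.
Proof.
rewrite !mpolyXn -!mpolyXD; congr 'X_[_]; apply/mnmP=> r.
rewrite !mnmDE !mulmnE !mnm1E !mnmE [i == r]eq_sym [nxt i == r]eq_sym -/j.
case: (eqVneq r i) => [->|_] /=; first by rewrite eq_sym nji !mul1n !mul0n !addn0.
by case: (eqVneq r j) => _ /=; rewrite ?mul1n ?mul0n ?addn0.
Qed.

Lemma sy_setij m a b : msym (sxp i) 'X_[setij m a b] = 'X_[setij m b a] :> {mpoly int[n]}.
Proof.
rewrite msymX /sxp tpermV; congr 'X_[_]; apply/mnmP=> r; rewrite !mnmE -/j.
case: tpermP => [->|->|/eqP/negbTE -> /eqP/negbTE ->] //; by rewrite ?eqxx ?nji ?eqxx.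
Qed.

Lemma XM_setij m a b : 'X_i * 'X_[setij m a b] = 'X_[setij m a.+1 b] :> {mpoly int[n]}.
Proof. by rewrite (setijX m a b) (setijX m a.+1 b) exprS; ring. Qed.

(** Once the symmetric factor (x_i x_(i+1))^b is removed, this is the factorisation of X^d - Y^d
    with d = a + 1 - b. For b = a + 1 the sum is empty and both sides vanish. *)
Lemma dem_setij m a b : (b <= a.+1)%N ->
  dem i 'X_[setij m a b] = \sum_(t < a.+1 - b) 'X_[setij m (a - t) (b + t)].
Proof.
move=> ab; apply: divdiff_unique => //; rewrite XM_setij sy_setij.
set d := (a.+1 - b)%N.
rewrite (eq_bigr (fun t : 'I_d => 'X_[setij m b b] *
   ('X_i ^+ (d.-1 - t) * 'X_(nxt i) ^+ t))); last first.
  move=> t _; rewrite (setijX m b b) (setijX m (a - t) (b + t)) -!mulrA; congr (_ * _).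
  have -> : (a - t = b + (d.-1 - t))%N by have := ltn_ord t; rewrite /d; lia.
  by rewrite !exprD; ring.
rewrite -big_distrr /= mulrCA -subrXX.
have -> : a.+1 = (b + d)%N by rewrite /d; lia.
by rewrite (setijX m b b) (setijX m (b + d) b) (setijX m b (b + d)) !exprD; ring.
Qed.

(** The reflection s_i exchanges x_i^(a+1) x_(i+1)^b and x_i^b x_(i+1)^(a+1), and ∂_i changes sign
    under it. *)
Lemma dem_setij_opp m a b : (a.+1 < b)%N ->
  dem i 'X_[setij m a b] = - dem i 'X_[setij m b.-1 a.+1].
Proof.
case: b => // b ab; apply: divdiff_unique => //.
by rewrite mulrN divdiffE !XM_setij !sy_setij opprB.
Qed.

(** The exponents [k] on the segment from [m] to s_i m: the support of π_i x^m when m_(i+1) <= m_i +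
    1. *)
Definition istring m k :=
  [&& k == setij m (k i) (k (nxt i)), (k i + k (nxt i) == m i + m (nxt i))%N
    & (m (nxt i) <= k i <= m i)%N].

Lemma mcoeff_demX m k : (m (nxt i) <= (m i).+1)%N ->
  (dem i 'X_[m])@_k = (istring m k)%:R.
Proof.
move=> h; rewrite -{1}[m]setij_id dem_setij // raddf_sum /=.
case: (boolP (istring m k)) => [/and3P[/eqP ek /eqP es /andP[h1 h2]]|nk]; last first.
  rewrite big1 // => t _; rewrite mcoeffX; case: eqP => // e; case/negP: nk.
  have lt := ltn_ord t; rewrite /istring -e setij_l setij_r.
  apply/and3P; split; [|lia|lia].
  apply/eqP/mnmP => r; rewrite !mnmE.
  by case: (r == i); case: (r == nxt i).
have ht : (m i - k i < (m i).+1 - m (nxt i))%N by lia.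
rewrite (bigD1 (Ordinal ht)) //= mcoeffX.
have -> : (m i - (m i - k i) = k i)%N by lia.
have -> : (m (nxt i) + (m i - k i) = k (nxt i))%N by lia.
rewrite -ek eqxx big1 ?addr0 // => t tn; rewrite mcoeffX; case: eqP => // e.
case/eqP: tn; apply: val_inj => /=; move: (congr1 (fun m : 'X_{1..n} => m i) e).
by rewrite setij_l; have := ltn_ord t; lia.
Qed.

Lemma dem_linear p : dem i p = \sum_(m <- msupp p) p@_m *: dem i 'X_[m].
Proof.
have dD q1 q2 : dem i (q1 + q2) = dem i q1 + dem i q2.
  by rewrite /dem mulrDr divdiffD.
have dZ c q : dem i (c *: q) = c *: dem i q by rewrite /dem -scalerAr divdiffZ.
have d0 : dem i 0 = 0 by rewrite -{1}[0](scale0r 0) dZ scale0r.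
by rewrite {1}[p]mpolyE (big_morph _ dD d0); apply: eq_bigr => m _; rewrite dZ.
Qed.

(** No order of the two exponents is assumed: if m_(i+1) > m_i + 1, [dem_setij_opp] gives a string
    strictly between them, only with negative signs. *)
Lemma msupp_dem p k : k \in msupp (dem i p) ->
  exists m, [/\ m \in msupp p, forall r, r != i -> r != nxt i -> k r = m r,
    (k i + k (nxt i) = m i + m (nxt i))%N
    & (minn (m i) (m (nxt i)) <= k i <= maxn (m i) (m (nxt i)))%N].
Proof.
have key m : (m (nxt i) <= (m i).+1)%N -> k \in msupp (dem i 'X_[m]) ->
    [/\ forall r, r != i -> r != nxt i -> k r = m r,
      (k i + k (nxt i) = m i + m (nxt i))%N & (m (nxt i) <= k i <= m i)%N].
  move=> h; rewrite mcoeff_msupp mcoeff_demX //.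
  case: (boolP (istring m k)); last by rewrite eqxx.
  case/and3P=> /eqP ek /eqP es h12 _; split=> // r r1 r2.
  by rewrite ek setij_o.
rewrite dem_linear => kS.
have [m mp km] : exists2 m, m \in msupp p & k \in msupp (dem i 'X_[m]).
  apply/hasP; apply: contraLR kS => /hasPn none; rewrite mcoeff_msupp negbK.
  rewrite raddf_sum /= big_seq big1 // => m /none; rewrite mcoeff_msupp negbK => /eqP e.
  by rewrite mcoeffZ e mulr0.
exists m; case: (leqP (m (nxt i)) (m i).+1) => [h|h].
  by have [a b c] := key m h km; split=> //; lia.
move: km; rewrite -[m]setij_id dem_setij_opp // (perm_mem (msuppN _)) => km.
have [|a b c] := key _ _ km; first by rewrite setij_l setij_r; lia.
rewrite !setij_l !setij_r in b c; rewrite setij_id; split=> //; try lia.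
by move=> r r1 r2; rewrite a // setij_o.
Qed.

(** The condition on exponents makes every π_i x^m a sum of monomials with coefficient 1; the
    uniqueness condition makes the supports of these sums disjoint. *)
Lemma zero_one_dem p : zero_one p ->
  {in msupp p, forall m, (m (nxt i) <= (m i).+1)%N} ->
  {in msupp p &, forall m m' k, istring m k -> istring m' k -> m = m'} ->
  zero_one (dem i p).
Proof.
move=> zp hm uni k.
have -> : (dem i p)@_k = \sum_(m <- msupp p) p@_m * (istring m k)%:R.
  rewrite dem_linear raddf_sum /= !big_seq; apply: eq_bigr => m mp.
  by rewrite mcoeffZ mcoeff_demX // hm.
case: (boolP (has (istring^~ k) (msupp p))) => [/hasP[m0 m0p sk]|/hasPn none]; last first.
  by left; rewrite big_seq big1 // => m /none /negbTE ->; rewrite mulr0.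
rewrite (bigD1_seq m0) ?msupp_uniq //= sk mulr1 big_seq_cond big1 ?addr0 // => m.
case/andP=> mp nm; case: (boolP (istring m k)) => sm; last by rewrite mulr0.
by rewrite (uni _ _ mp m0p k sm sk) eqxx in nm.
Qed.

Lemma istringP m k : istring m k -> [/\ forall r, r != i -> r != nxt i -> k r = m r,
   (k i + k (nxt i) = m i + m (nxt i))%N & (m (nxt i) <= k i <= m i)%N].
Proof.
by case/and3P=> /eqP ek /eqP es h12; split=> // r r1 r2; rewrite ek setij_o.
Qed.

Lemma mnm_ij_eq m m' : (forall r, r != i -> r != nxt i -> m r = m' r) ->
  m i = m' i -> m (nxt i) = m' (nxt i) -> m = m'.
Proof.
move=> h h1 h2; apply/mnmP=> r; case: (eqVneq r i) => [->//|r1].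
by case: (eqVneq r (nxt i)) => [->//|r2]; apply: h.
Qed.

(** A nonempty string needs m_i >= m_(i+1), which leaves the pairs (0,0), (1,0), (1,1); the sum k_i
    + k_(i+1) tells them apart. *)
Lemma zero_one_dem_small p : zero_one p ->
  {in msupp p, forall m, (m i <= 1)%N /\ (m (nxt i) <= 1)%N} ->
  zero_one (dem i p).
Proof.
move=> zp h; apply: zero_one_dem => // [m /h[]|m m' /h[a b] /h[a' b'] k].
  lia.
move=> /istringP[e1 e2 e3] /istringP[f1 f2 f3].
by apply: mnm_ij_eq; [move=> r r1 r2; rewrite -e1 ?f1|lia|lia].
Qed.

(** [N] gives dominance. Monomials whose strings share [k] agree off x_i and x_(i+1), so the fixed
    degree [e] in the variables up to x_i forces equal m_i, and then equal m_(i+1). *)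
Lemma zero_one_dem_sep p (N e : nat) : zero_one p ->
  {in msupp p, forall m, (m (nxt i) <= N <= m i)%N /\
      (\sum_(r < n | (r <= i)%N) m r = e)%N} ->
  zero_one (dem i p).
Proof.
move=> zp h; apply: zero_one_dem => // [m /h[]|m m' /h[a b] /h[a' b'] k].
  lia.
move=> /istringP[e1 e2 e3] /istringP[f1 f2 f3].
have mi : m i = m' i.
  move: b; rewrite (bigD1 i) //= => b; move: b'; rewrite (bigD1 i) //=.
  rewrite (eq_bigr (fun r => m r)); first lia.
  move=> r /andP[ri nr]; have rn : r != nxt i by rewrite -val_eqE /= val_nxt //; lia.
  by rewrite -e1 ?f1.
by apply: mnm_ij_eq; [move=> r r1 r2; rewrite -e1 ?f1|lia|lia].
Qed.

End DemazureMonomials.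

(** * Orthodontia of diagrams *)

Section OrthodontiaSteps.
Variable n : nat.
Implicit Types (i r : 'I_n) (c d : 'I_n) (C : {set 'I_n}) (D : diagram n)
  (p q : {mpoly int[n]}) (m k : 'X_{1..n}) (K : nat).

Definition rswap i C : {set 'I_n} := [set r | sxp i r \in C].

Definition estep i D : diagram n :=
  [ffun c => if rswap i (D c) == initcol n i.+1 then set0 else rswap i (D c)].

Definition mult i D : nat := (\sum_c (rswap i (D c) == initcol n i.+1))%N.

Definition lead D c := D c != set0 /\ forall d, (d < c)%N -> D d = set0.

(** The last clause is minimality: no smaller row is a missing tooth. *)
Definition tooth C i := [/\ (i.+1 < n)%N, i \notin C, nxt i \in C &
  forall r, (r < i)%N -> nxt r \in C -> r \in C].

Definition xcol C : {mpoly int[n]} := 'X_[ [multinom nat_of_bool (r \in C) | r < n] ].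

(* [orth D s p]: the orthodontia of [D] terminates with data [s], and [p] is the
   nested product of Demazure operators and monomials read off along it (rows
   are 0-based, so [xcol (initcol n i.+1)] is x_1...x_(i+1)). *)
Inductive orth : diagram n -> seq (nat * {set 'I_n}) -> {mpoly int[n]} -> Prop :=
| orth_nil D : (forall c, D c = set0) -> orth D [::] 1
| orth_cons D c i s p : lead D c -> tooth (D c) i -> orth (estep i D) s p ->
    orth D ((i.+1, [set d | nxt i \in D d]) :: s)
         (dem i (xcol (initcol n i.+1) ^+ mult i D * p)).

Lemma inC_val C r : inC C r = (r \in C).
Proof.
apply/existsP/idP => [[x /andP[xC /eqP/val_inj <-]] //|rC].
by exists r; rewrite rC eqxx.
Qed.

Lemma inC_lt C t : inC C t -> (t < n)%N.
Proof. by case/existsP => x /andP[_ /eqP <-]; exact: ltn_ord. Qed.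

Lemma tswapE i r : (i.+1 < n)%N -> tswap i r = sxp i r.
Proof.
move=> hi; rewrite /tswap /sxp; case: tpermP => [->|->|/eqP ri /eqP rj].
- by rewrite eqxx val_nxt.
- by rewrite val_nxt // eqxx; case: eqP => //; lia.
- move: ri rj; rewrite -!val_eqE /= val_nxt //.
  by move=> /negbTE -> /negbTE ->.
Qed.

Lemma ohead_filter_min (T : eqType) (f : T -> nat) (P : pred T) (s : seq T) x :
  sorted ltn (map f s) -> ohead (filter P s) = Some x ->
  [/\ x \in s, P x & forall y, y \in s -> (f y < f x)%N -> ~~ P y].
Proof.
elim: s => //= a s IH ps.
have ss : sorted ltn (map f s) by exact: path_sorted ps.
case: ifP => Pa => [[<-]|e].
  split=> // [|y]; first exact: mem_head.
  rewrite inE => /predU1P[->|ys]; first by rewrite ltnn.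
  have /allP/(_ (f y)) : all (ltn (f a)) (map f s) by apply: order_path_min ps => ? ? ?; apply: ltn_trans.
  by rewrite map_f //= => /(_ isT); lia.
have [xs Px mn] := IH ss e; split=> // [|y]; first by rewrite inE xs orbT.
by rewrite inE => /predU1P[->|ys] lt; [rewrite Pa|apply: mn].
Qed.

Lemma ortho_stepP D t imp E : ortho_step D = Some (t, imp, E) ->
  exists c i, [/\ lead D c, tooth (D c) i, t = i.+1, imp = [set d | nxt i \in D d]
    & E = estep i D].
Proof.
rewrite /ortho_step.
case e1: (ohead _) => [c|//]; case e2: (ohead _) => [t0|//] [<- <- <-].
have [|_ nz mn] := ohead_filter_min (f := @nat_of_ord n) _ e1.
  by rewrite val_enum_ord iota_ltn_sorted.
have [|] := ohead_filter_min (f := id) _ e2; first by rewrite map_id iota_ltn_sorted.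
rewrite mem_iota add0n /= => t0n /andP[nt0 t1] mn2.
have hi := inC_lt t1; pose i := Ordinal t0n.
have vi : nxt i = t0.+1 :> nat by rewrite val_nxt.
exists c, i; split=> //.
- split=> // d dc; apply/eqP; rewrite -[_ == _]negbK; apply: mn => //.
  by rewrite mem_enum.
- split=> //; first by rewrite -inC_val.
    by rewrite -inC_val vi.
  move=> r ri rn; have := mn2 r; rewrite mem_iota add0n ltn_ord ri => /(_ isT isT).
  have vr : nxt r = r.+1 :> nat by rewrite val_nxt //; move: ri => /=; lia.
  by rewrite inC_val -vr inC_val rn andbT negbK.
- by apply/setP=> d; rewrite !inE -inC_val vi.
- have O d : [set r : 'I_n | inC (D d) (tswap t0 r)] = rswap i (D d).
    by apply/setP=> r; rewrite !inE (tswapE (i := i)) // inC_val.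
  by apply/ffunP=> d; rewrite !ffunE O.
Qed.

Lemma ortho_run_orth fuel D s Df : ortho_run fuel D = (s, Df) -> all_empty Df ->
  exists p, orth D s p.
Proof.
elim: fuel D s => [|f IH] D s /=.
  by case=> <- <- /forallP e; exists 1; apply: orth_nil => c; apply/eqP.
case e: (ortho_step D) => [[[t imp] E]|]; last first.
  by case=> <- <- /forallP h; exists 1; apply: orth_nil => c; apply/eqP.
case e2: (ortho_run f E) => [s' Df'] [<- eD]; rewrite eD in e2 => /(IH _ _ e2)[p op].
have [c [i [h1 h2 -> -> eE]]] := ortho_stepP e; rewrite eE in op.
by eexists; apply: orth_cons h1 h2 op.
Qed.

Lemma in_initcol K r : (r \in initcol n K) = (r < K)%N.
Proof. by rewrite inE. Qed.

Lemma rswap_inv i C : (i \in C) = (nxt i \in C) -> rswap i C = C.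
Proof.
by move=> e; apply/setP=> r; rewrite inE /sxp; case: tpermP => [->|->|].
Qed.

Lemma rswapK i : involutive (rswap i).
Proof. by move=> C; apply/setP=> r; rewrite !inE /sxp tpermK. Qed.

Lemma rswap_initcol i K : (i.+1 < n)%N -> i.+1 != K -> rswap i (initcol n K) = initcol n K.
Proof.
by move=> hi iK; apply: rswap_inv; rewrite !in_initcol val_nxt // [RHS]ltn_neqAle iK.
Qed.

Lemma rswapS i C1 C2 : (rswap i C1 \subset rswap i C2) = (C1 \subset C2).
Proof.
have h (A B : {set 'I_n}) : A \subset B -> rswap i A \subset rswap i B.
  by move=> /subsetP s; apply/subsetP=> r; rewrite !inE => /s.
by apply/idP/idP => [/h|/h //]; rewrite !rswapK.
Qed.

(* Along the run, row [i] is empty in every column when rows [i] and [i.+1] are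
   swapped; this is what [northwest] is for. *)
Definition northwest D := forall c d r r', (c < d)%N -> r \in D d -> r' \in D c ->
  (r <= r')%N -> r \in D c.

(** Columns left of [c] are empty, and a cell of row [r] further right would force one in column [c]
    by [northwest]. *)
Lemma lead_row D c r r' : northwest D -> lead D c -> (r <= r')%N -> r' \in D c ->
  r \notin D c -> forall d, r \notin D d.
Proof.
move=> nw [_ l] rr r'c rc d; apply/negP => rd.
case: (ltngtP d c) => [/l e|cd|/val_inj e]; first by rewrite e inE in rd.
  by case/negP: rc; apply: nw cd rd r'c rr.
by rewrite -e rd in rc.
Qed.

Lemma northwest_row D c i : northwest D -> lead D c -> tooth (D c) i ->
  forall d, i \notin D d.
Proof.
by move=> nw l [hi ni ii _]; apply: (lead_row nw l _ ii ni); rewrite val_nxt.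
Qed.

Lemma estepE i D d r : r \in estep i D d -> sxp i r \in D d /\ estep i D d = rswap i (D d).
Proof. by rewrite ffunE; case: ifP => _; rewrite inE. Qed.

(** As row [i] is empty in every column, the step only moves row [i.+1] up by one, which keeps the
    order of the occupied rows; discarded columns satisfy the condition vacuously. *)
Lemma northwest_estep D c i : northwest D -> lead D c -> tooth (D c) i ->
  northwest (estep i D).
Proof.
move=> nw l t; have row := northwest_row nw l t; have [hi _ _ _] := t.
move=> a b r r' ab /estepE[rb _] /estepE[ra ->] rr; rewrite inE.
apply: (nw _ _ _ _ ab rb ra).
have vs x : sxp i x != i -> sxp i x = (if x == i then i.+1 else x) :> nat.
  rewrite /sxp; case: tpermP => [->|->|/eqP/negbTE -> _] //; last by rewrite eqxx.
  by rewrite eqxx val_nxt.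
have n1 : sxp i r != i by apply: (contraTneq _ rb) => ->.
have n2 : sxp i r' != i by apply: (contraTneq _ ra) => ->.
have n3 : r != nxt i by apply: contraNneq n1 => ->; rewrite sxp_r.
have n4 : r' != nxt i by apply: contraNneq n2 => ->; rewrite sxp_r.
rewrite !vs //; move: n3 n4; rewrite -!val_eqE /= val_nxt //.
by move=> n3 n4; do 2!case: ifP; lia.
Qed.

Definition comparable K C := (C \subset initcol n K) || (initcol n K \subset C).

Lemma comparable_rswap K i C : (i.+1 < n)%N -> i.+1 != K ->
  comparable K (rswap i C) = comparable K C.
Proof. by move=> hi iK; rewrite /comparable -{1 2}(rswap_initcol hi iK) !rswapS. Qed.

Lemma comparable_initcol K L : comparable K (initcol n L).
Proof.
apply/orP; case: (leqP L K) => h; [left|right]; apply/subsetP=> r; rewrite !in_initcol; lia.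
Qed.

Lemma comparable0 K : comparable K set0.
Proof. by rewrite /comparable sub0set. Qed.

(* The number of cells of column [d] in rows [<= i] changes only at steps with
   tooth [i] that meet [d], and column [d] ends as an initial segment. *)
Lemma orth_comparable D s p d i : orth D s p -> northwest D ->
  (forall x, x \in s -> x.1 = i.+1 -> d \notin x.2) -> comparable i.+1 (D d).
Proof.
elim=> {D s p} [D e _ _|D c j s p l t op IH nw h]; first by rewrite e comparable0.
have [hj _ _ _] := t.
have {}IH : comparable i.+1 (estep j D d).
  apply: IH; first exact: northwest_estep l t.
  by move=> x xs; apply: h; rewrite inE xs orbT.
have [e|ne] := eqVneq (j : nat) i.
  have nd : nxt j \notin D d by have := h _ (mem_head _ _); rewrite /= e inE; apply.
  have jd := northwest_row nw l t d.
  have e2 : rswap j (D d) = D d by apply: rswap_inv; rewrite (negbTE nd) (negbTE jd).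
  move: IH; rewrite ffunE e2; case: eqP => // e3.
  by rewrite e3 in_initcol ltnSn in jd.
rewrite -(comparable_rswap _ hj); last by rewrite eqSS.
move: IH; rewrite ffunE; case: eqP => // -> _; exact: comparable_initcol.
Qed.

(** For columns comparable with [initcol n K], this counts those that contain it strictly. *)
Definition nout K D : nat := (\sum_d ~~ (D d \subset initcol n K))%N.

Lemma rswap_sub K i C : (i.+1 < n)%N -> i.+1 != K ->
  (rswap i C \subset initcol n K) = (C \subset initcol n K).
Proof. by move=> hi iK; rewrite -{1}(rswap_initcol hi iK) rswapS. Qed.

(** A column discarded here becomes [initcol n i.+1], which reaches beyond the first [K] rows, so it
    was counted before the step. *)
Lemma nout_estep_ge K i D : (i.+1 < n)%N -> (K <= i)%N ->
  nout K D = (nout K (estep i D) + mult i D)%N.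
Proof.
move=> hi Ki; rewrite -big_split /=; apply: eq_bigr => d _.
rewrite ffunE -(rswap_sub (D d) hi); last by lia.
case: eqP => [->|_]; last by rewrite addn0.
rewrite sub0set /=; case: subsetP => // /(_ i); rewrite !in_initcol ltnSn => /(_ isT).
lia.
Qed.

Lemma nout_estep_lt K i D : (i.+1 < n)%N -> (i.+1 < K)%N -> nout K D = nout K (estep i D).
Proof.
move=> hi Ki; apply: eq_bigr => d _.
rewrite ffunE -(rswap_sub (D d) hi); last by lia.
case: eqP => [->|_] //; rewrite sub0set; case: subsetP => // ns; case: ns => r.
by rewrite !in_initcol; lia.
Qed.

Lemma comparable_estep K i D : (i.+1 < n)%N -> i.+1 != K ->
  (forall d, comparable K (D d)) -> forall d, comparable K (estep i D d).
Proof.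
move=> hi iK h d; rewrite ffunE; case: eqP => _; first exact: comparable0.
by rewrite comparable_rswap.
Qed.

Lemma msupp_xcolM C a p m : m \in msupp (xcol C ^+ a * p) ->
  exists2 m', m' \in msupp p & forall r, m r = (m' r + (r \in C) * a)%N.
Proof.
rewrite mpolyXn mulrC (perm_mem (msuppMX _ _)) => /mapP[m' m'p ->]; exists m' => // r.
by rewrite mnmDE mulmnE mnmE addnC.
Qed.

Lemma zero_one_XM p m : zero_one p -> zero_one ('X_[m] * p).
Proof.
move=> zp k; rewrite mulrC; case: (boolP (k \in msupp (p * 'X_[m]))) => [|nk]; last first.
  by left; apply/eqP; rewrite mcoeff_eq0.
by rewrite (perm_mem (msuppMX _ _)) => /mapP[k' _ ->]; rewrite mcoeffMX.
Qed.

(* Swaps never cross row [K], so the variables of index [< K] and [>= K] do not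
   interact; each column containing [initcol n K] contributes the full product
   of the former. *)
Lemma orth_exponents K D s p : orth D s p -> (forall d, comparable K (D d)) ->
  exists e, forall m, m \in msupp p ->
    [/\ forall r, (r < K)%N -> (nout K D <= m r)%N, forall r, (K <= r)%N -> (m r <= nout K D)%N
      & (\sum_(r < n | (r < K)%N) m r = e)%N].
Proof.
elim=> {D s p} [D e _|D c i s p l t op IH h].
  exists 0%N => m; rewrite msupp1 inE => /eqP ->.
  have -> : nout K D = 0%N by rewrite /nout big1 // => d _; rewrite e sub0set.
  by split=> [r _|r _|]; rewrite ?mnm0E // big1 // => r _; rewrite mnm0E.
have [hi ni ii _] := t; have vi := val_nxt hi.
(* Otherwise column [c] would contain row [K] but miss row [K - 1], against comparability. *)
have iK : i.+1 != K.
  apply: contraTneq (h c) => iK; rewrite negb_or; apply/andP; split; apply/negP=> /subsetP.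
    by move=> /(_ _ ii); rewrite in_initcol vi -iK ltnn.
  by move/(_ i); rewrite in_initcol -iK ltnSn (negbTE ni) => /(_ isT).
have [e IHe] := IH (comparable_estep hi iK h).
exists (e + \sum_(r < n | (r < K)%N) (r \in initcol n i.+1) * mult i D)%N => k.
move=> /(msupp_dem hi)[m [/msupp_xcolM[m' /IHe[B1 B2 B3] em] ko ks kb]].
have {}em r : m r = (m' r + (r < i.+1) * mult i D)%N by rewrite em in_initcol.
have [A1 A2] : (forall r, (r < K)%N -> (nout K D <= m r)%N) /\
    (forall r, (K <= r)%N -> (m r <= nout K D)%N).
  have [Ki|Ki] := leqP K i.
    rewrite (nout_estep_ge D hi Ki); split=> r rK; rewrite em.
      have ri : (r < i.+1)%N by lia.
      by have := B1 r rK; rewrite ri mul1n; lia.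
    by have := B2 r rK; case: (r < i.+1)%N; rewrite ?mul1n ?mul0n; lia.
  have {}Ki : (i.+1 < K)%N by lia.
  rewrite (nout_estep_lt D hi Ki); split=> r rK; rewrite em; first by have := B1 r rK; lia.
  have ri : (r < i.+1)%N = false by lia.
  by have := B2 r rK; rewrite ri mul0n addn0.
have kE r : [\/ r = i, r = nxt i | [/\ r != i, r != nxt i & k r = m r]].
  case: (eqVneq r i) => [->|r1]; first by constructor 1.
  case: (eqVneq r (nxt i)) => [->|r2]; first by constructor 2.
  by constructor 3; rewrite ko.
(* Rows [i] and [i.+1] lie on the same side of [K]. By [msupp_dem] the new exponents stay between
   the old ones with the same sum, so all three properties pass from [m] to [k]. *)
split.
- move=> r rK; case: (kE r) => [e1|e1|[_ _ ->]]; last exact: A1.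
    have := A1 i; have := A1 (nxt i); rewrite vi; move: rK; rewrite e1; lia.
  have := A1 i; have := A1 (nxt i); rewrite vi; move: rK; rewrite e1 vi; lia.
- move=> r rK; case: (kE r) => [e1|e1|[_ _ ->]]; last exact: A2.
    have := A2 i; have := A2 (nxt i); rewrite vi; move: rK; rewrite e1; lia.
  have := A2 i; have := A2 (nxt i); rewrite vi; move: rK; rewrite e1 vi; lia.
rewrite -B3 -big_split /=.
rewrite [RHS](eq_bigr (fun r => m r)); last by move=> r _; rewrite em in_initcol.
have nij := nxt_neq hi.
have [Ki|Ki] := leqP K i.
  apply: eq_bigr => r rK; case: (kE r) => [e1|e1|[_ _ ->]] //.
    by move: rK; rewrite e1; lia.
  by move: rK; rewrite e1 vi; lia.
have jK : (nxt i < K)%N by rewrite vi; lia.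
rewrite (bigD1 i) //= (bigD1 (nxt i)) /=; last by rewrite jK eq_sym.
rewrite [RHS](bigD1 i) //= [X in _ = (_ + X)%N](bigD1 (nxt i)) /=; last by rewrite jK eq_sym.
rewrite !addnA ks; congr (_ + _)%N; apply: eq_bigr => r /andP[/andP[_ r1] r2].
exact: ko.
Qed.

(** Without an earlier missing tooth, the rows of [C] up to [i] are closed downwards; [K] is the
    first row not in [C]. *)
Lemma tooth_initial C i : tooth C i ->
  exists2 K, (K <= i)%N & forall r, (r <= i)%N -> (r \in C) = (r < K)%N.
Proof.
case=> hi ni _ mn.
have down (r : 'I_n) t : (r <= i)%N -> r \in C -> (t <= r)%N -> inC C t.
  move=> ri rC tr; rewrite -(subKn tr); elim: (r - t)%N (leq_subr t r) => [|a IH] ar.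
    by rewrite subn0 inC_val.
  have lt : (r - a.+1 < n)%N by have := ltn_ord r; lia.
  have {IH} := IH (ltnW ar).
  have e : (r - a = nxt (Ordinal lt))%N by rewrite val_nxt /=; lia.
  rewrite e inC_val => /mn; rewrite -(inC_val C (Ordinal lt)); apply => /=; lia.
have ex : exists t, ~~ inC C t by exists i; rewrite inC_val.
case: (ex_minnP ex) => K nK mK; exists K; first by apply: mK; rewrite inC_val.
move=> r ri; apply/idP/idP => [rC|rK].
  by rewrite ltnNge; apply: contra nK => Kr; apply: down rC Kr.
by rewrite -inC_val -[inC _ _]negbK; apply/negP => /mK; lia.
Qed.

Lemma mf_tail (x : nat * {set 'I_n}) s : mf_condition (x :: s) -> mf_condition s.
Proof. by move=> h a b la lb ab; apply: (h a.+1 b.+1) => // -[]. Qed.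

Lemma mf_head (x y : nat * {set 'I_n}) s : mf_condition (x :: s) -> y \in s -> y.1 = x.1 ->
  exists c, x.2 = [set c] /\ y.2 = [set c].
Proof.
move=> h /(nthP (0%N, set0))[b lb <-] e.
by have := h 0%N b.+1 isT lb; apply.
Qed.

Theorem orth_zero_one D s p : orth D s p -> northwest D -> mf_condition s -> zero_one p.
Proof.
elim=> {D s p} [D e _ _|D c i s p l t op IH nw mf].
  by move=> m; rewrite mcoeff1; case: (m == 0%MM); [right|left].
have [hi ni ii _] := t; have vi := val_nxt hi.
have nw' := northwest_estep nw l t.
have zq : zero_one (xcol (initcol n i.+1) ^+ mult i D * p).
  by rewrite mpolyXn; apply/zero_one_XM/IH => //; apply: mf_tail mf.
case: (boolP (has (fun x => x.1 == i.+1) s)) => [/hasP[y ys /eqP y1]|/hasPn none]; last first.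
  (* The tooth does not recur: no later step crosses between rows [i] and [i.+1], and [nout i.+1]
     separates the two exponents. *)
  have cmp d : comparable i.+1 (estep i D d).
    by apply: orth_comparable op nw' _ => x /none /eqP.
  have [e he] := orth_exponents op cmp.
  apply: (@zero_one_dem_sep _ _ hi _ (nout i.+1 (estep i D))
    (e + \sum_(r < n | (r <= i)%N) (r \in initcol n i.+1) * mult i D)%N) => // m.
  move=> /msupp_xcolM[m' /he[B1 B2 B3] em]; split.
    have := B1 i (ltnSn i); have := B2 (nxt i); rewrite vi => /(_ (leqnn _)).
    rewrite !em !in_initcol vi ltnn ltnSn; lia.
  by rewrite -B3 -big_split; apply: eq_bigr => r _; rewrite em.
(* The tooth recurs, so the impact is a singleton; it contains [c]. *)
have cimp : c \in [set d | nxt i \in D d] by rewrite inE.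
have [c' /= [e1 _]] := mf_head mf ys y1.
have ec : c' = c by move: cimp; rewrite e1 inE => /eqP.
subst c'.
have [K Ki hK] := tooth_initial t.
(* Column [d] never meets a step with tooth [i], hence is comparable with [initcol n i.+1]; as row
   [i] is empty, it lies inside. By [northwest] its rows then belong to column [c], that is, to the
   first [K]. *)
have sub d : d != c -> D d \subset initcol n K.
  move=> dc; have cmp : comparable i.+1 (D d).
    apply: (orth_comparable (orth_cons l t op)) => // x; rewrite inE => /predU1P[-> _|xs x1] /=.
      by rewrite e1 inE.
    have [c' /= [e2 ->]] := mf_head mf xs x1.
    by move: e2; rewrite e1 => /set1_inj <-; rewrite inE.
  have row := northwest_row nw l t d.
  have {}cmp : D d \subset initcol n i.+1.
    by case/orP: cmp => // /subsetP/(_ i); rewrite in_initcol ltnSn (negbTE row) => /(_ isT).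
  apply/subsetP=> r rd; have := subsetP cmp r rd; rewrite !in_initcol ltnS => ri.
  rewrite -hK //; case: l => _ l.
  case: (ltngtP d c) => [/l e|cd|/val_inj e]; first by rewrite e inE in rd.
    by apply: nw cd rd ii _; rewrite vi; lia.
  by rewrite e eqxx in dc.
have iK : i.+1 != K by lia.
have cmp d : comparable K (D d).
  apply/orP; case: (eqVneq d c) => [->|/sub]; [right|by left].
  by apply/subsetP=> r; rewrite in_initcol => rK; rewrite hK //; lia.
have [e he] := orth_exponents op (comparable_estep hi iK cmp).
(* Only column [c] can reach beyond the first [K] rows. Since [K <= i], this bounds the exponents of
   both x_i and x_(i+1) by 1. *)
have le1 : (nout K (estep i D) + mult i D <= 1)%N.
  rewrite -nout_estep_ge // /nout (bigD1 c) //= big1 ?addn0 ?leq_b1 // => d /sub ->.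
  by [].
apply: zero_one_dem_small => // m /msupp_xcolM[m' /he[_ B2 _] em].
have := B2 i Ki; have := B2 (nxt i); rewrite vi !em => /(_ (leqW Ki)).
by do 2!case: (_ \in initcol _ _); lia.
Qed.

End OrthodontiaSteps.

(** * Schubert polynomials and Rothe diagrams *)

Section Schubert.
Variable n : nat.
Implicit Types (w : 'S_n) (i j r c d : 'I_n) (C : {set 'I_n}) (D : diagram n)
  (f p q : {mpoly int[n]}).

Lemma sxp_lt i r r' : (i.+1 < n)%N -> (r < r')%N -> ~ (r = i /\ r' = nxt i) ->
  (sxp i r < sxp i r')%N.
Proof.
move=> hi rr nn; have v := val_nxt hi.
have e x : sxp i x = (if x == i then i.+1 else if x == nxt i then i else x) :> nat.
  rewrite /sxp; case: tpermP => [->|->|/eqP/negbTE -> /eqP/negbTE ->] //.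
    by rewrite eqxx.
  by rewrite eqxx eq_sym (negbTE (nxt_neq hi)).
rewrite !e -!val_eqE /= v.
have {}nn : ~ (r = i :> nat /\ r' = i.+1 :> nat).
  by case=> a b; apply: nn; split; apply: val_inj; rewrite //= v.
by do 4?case: ifP; lia.
Qed.

Lemma ascentP w i : ascent w i -> (i.+1 < n)%N /\ (w i < w (nxt i))%N.
Proof. by case/andP. Qed.

(** Counts non-inversions, the distance from [w] up to the longest element; it is the induction
    measure for the recursion along ascents. *)
Definition ninv w : nat := #|[set x : 'I_n * 'I_n | (x.1 < x.2)%N && (w x.1 < w x.2)%N]|.

(** Swapping positions [i] and [i.+1] injects the non-inversions of the new permutation into those
    of [w], and misses the pair [(i, nxt i)]. *)
Lemma ninv_sxp w i : ascent w i -> (ninv (sxp i * w)%g < ninv w)%N.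
Proof.
case/ascentP=> hi lt; rewrite /ninv; set A := [set x | _]; set B := [set x | _].
pose F (x : 'I_n * 'I_n) := (sxp i x.1, sxp i x.2).
have Finj : injective F by move=> [a b] [a' b'] [/perm_inj -> /perm_inj ->].
have iB : (i, nxt i) \in B by rewrite inE /= val_nxt // ltnSn lt.
rewrite -(card_imset (mem A) Finj) (cardsD1 (i, nxt i) B) iB add1n ltnS.
apply/subset_leq_card/subsetP=> _ /imsetP[[a b] + ->]; rewrite !inE /= !permM => /andP[ab wab].
rewrite wab andbT; apply/andP; split.
  apply/negP=> /eqP[/(canRL (tpermK _ _)) ea /(canRL (tpermK _ _)) eb].
  by move: ab; rewrite ea eb /sxp tpermL tpermR val_nxt //; lia.
apply: sxp_lt => // -[ea eb]; move: wab; rewrite ea eb sxp_l sxp_r; lia.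
Qed.

Lemma ohead_ascent w a : ohead [seq i <- enum 'I_n | ascent w i] = Some a ->
  ascent w a /\ forall i, (i < a)%N -> ~~ ascent w i.
Proof.
case/(ohead_filter_min (f := @nat_of_ord n)); first by rewrite val_enum_ord iota_ltn_sorted.
by move=> _ aa mn; split=> // i; apply: mn; rewrite mem_enum.
Qed.

Lemma schub_rec_fuel (f g : nat) w : (ninv w < f)%N -> (ninv w < g)%N ->
  schub_rec f w = schub_rec g w.
Proof.
elim: f g w => // f IH [//|g] w lf lg /=.
case e: (ohead _) => [a|//]; have [aa _] := ohead_ascent e.
by have lt := ninv_sxp aa; congr divdiff; apply: IH; lia.
Qed.

Lemma ninv_le w : (ninv w < (n * n).+1)%N.
Proof. by rewrite ltnS (leq_trans (max_card _)) // card_prod card_ord. Qed.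

Lemma schubert_none w : (forall i, ~~ ascent w i) -> schubert w = schub_w0 n.
Proof.
move=> na; rewrite /schubert /=; case e: (ohead _) => [a|//].
by have [aa _] := ohead_ascent e; have := na a; rewrite aa.
Qed.

Lemma schubert_first w : {a | [/\ ascent w a, forall i, (i < a)%N -> ~~ ascent w i &
    schubert w = divdiff a (schubert (sxp a * w)%g)]} + {forall i, ~~ ascent w i}.
Proof.
case e: (ohead [seq i <- enum 'I_n | ascent w i]) => [a|]; [left; exists a|right].
  have [aa mn] := ohead_ascent e; split=> //; rewrite /schubert [LHS]/= e; congr divdiff.
  apply: schub_rec_fuel; last exact: ninv_le.
  by apply: leq_trans (ninv_sxp aa) _; have := ninv_le w; lia.
move=> i; apply/negP=> ai.
have : i \in [seq i <- enum 'I_n | ascent w i] by rewrite mem_filter ai mem_enum.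
by case: (filter _ _) e.
Qed.

(** The definition uses the smallest ascent [a]. Any other ascent gives the same result by induction
    on [ninv]: distant ascents commute, adjacent ones satisfy the braid relation. *)
Lemma schubert_ascent w i : ascent w i -> schubert w = divdiff i (schubert (sxp i * w)%g).
Proof.
have [N] := ubnP (ninv w); elim: N w i => // N IH w b lN ab.
case: (schubert_first w) => [[a [aa mn Sw]]|/(_ b)]; last by rewrite ab.
have ale : (a <= b)%N by rewrite leqNgt; apply/negP=> /mn; rewrite ab.
have [<-|nab] := eqVneq a b; first exact: Sw.
have lab : (a < b)%N by rewrite ltn_neqAle nab ale.
have [ha la] := ascentP aa; have [hb lb] := ascentP ab.
have IH1 := ninv_sxp aa; have IH2 := ninv_sxp ab; rewrite Sw.
have [far|] := ltnP a.+1 b.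
  have [n1 n2 n3 n4] := nxt_far ha hb far.
  have a1 : ascent (sxp a * w)%g b by rewrite /ascent hb !permM /sxp !tpermD.
  have a2 : ascent (sxp b * w)%g a by rewrite /ascent ha !permM /sxp !tpermD // eq_sym.
  rewrite (IH _ _ _ a1); last by lia.
  rewrite [in RHS](IH _ _ _ a2); last by lia.
  by rewrite !mulgA (sxp_far ha hb far); exact: (divdiff_comm _ ha hb far).
(* Here [w] increases on three consecutive positions, so both reduced words of the longest element
   of S_3 proceed along ascents. *)
move=> ba; have eb : b = nxt a by apply: val_inj; rewrite /= val_nxt //; lia.
have ha2 : (a.+2 < n)%N by move: hb; rewrite eb val_nxt.
subst b; set b := nxt a in ab hb la lb IH2 *; set c := nxt b in lb *.
have vb : b = a.+1 :> nat by rewrite val_nxt.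
have vc : c = a.+2 :> nat by rewrite val_nxt // vb.
have sac : sxp a c = c by rewrite /sxp tpermD // -val_eqE /= ?vb vc; lia.
have sba : sxp b a = a by rewrite /sxp tpermD // -val_eqE /= ?vb ?vc; lia.
have [sab saa] : sxp a b = a /\ sxp a a = b by rewrite sxp_l sxp_r.
have [sbc sbb] : sxp b c = b /\ sxp b b = c by rewrite sxp_l sxp_r.
have a1 : ascent (sxp a * w)%g b by rewrite /ascent hb -/c !permM sab sac; lia.
have a2 : ascent (sxp b * (sxp a * w))%g a.
  by rewrite /ascent ha -/b !permM sba saa sbb sac; lia.
have a3 : ascent (sxp b * w)%g a by rewrite /ascent ha -/b !permM sba sbb; lia.
have a4 : ascent (sxp a * (sxp b * w))%g b.
  by rewrite /ascent hb -/c !permM sab sba sac sbc; lia.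
have l1 := ninv_sxp a1; have l3 := ninv_sxp a3.
rewrite (IH _ _ _ a1); last by lia.
rewrite (IH _ _ _ a2); last by lia.
rewrite [in RHS](IH _ _ _ a3); last by lia.
rewrite [in RHS](IH _ _ _ a4); last by lia.
by rewrite /b !mulgA (sxp_braid ha2); exact: (divdiff_braid ha2 _).
Qed.

Definition std C := [exists j : 'I_n.+1, C == initcol n j].

Lemma std_initcol K : (K <= n)%N -> std (initcol n K).
Proof. by rewrite -ltnS => lK; apply/existsP; exists (Ordinal lK). Qed.

Lemma E0E D c : ortho_E0 D c = if std (D c) then set0 else D c.
Proof. by rewrite ffunE. Qed.

Lemma in_rothe w c r : (r \in rothe w c) = (r < (w^-1)%g c)%N && (c < w r)%N.
Proof. by rewrite ffunE inE. Qed.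

(** The positions [i] and [i.+1] become an inversion, which creates the one new cell, in row [i] of
    column [w i]; all other cells follow the row swap. *)
Lemma rothe_sxp w i c : ascent w i -> rothe (sxp i * w)%g c =
  if c == w i then i |: rswap i (rothe w c) else rswap i (rothe w c).
Proof.
case/ascentP=> hi lt.
have [q ->] : exists q : 'I_n, c = w q by exists ((w^-1)%g c); rewrite permKV.
rewrite (inj_eq perm_inj).
have e r : (r \in rothe (sxp i * w)%g (w q)) = (r < sxp i q)%N && (w q < w (sxp i r))%N.
  by rewrite in_rothe invMg !permM permK tpermV.
have e2 r : (r \in rswap i (rothe w (w q))) = (sxp i r < q)%N && (w q < w (sxp i r))%N.
  by rewrite inE in_rothe permK.
have sK x : sxp i (sxp i x) = x by exact: tpermK.
have [qi|nq] := eqVneq q i.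
  apply/setP=> r; rewrite e in_setU1 e2 qi sxp_l.
  have [->|nr] := eqVneq r i; first by rewrite sxp_l val_nxt // ltnSn lt.
  congr (_ && _); rewrite val_nxt //= ltnS leq_eqVlt.
  rewrite -[_ == _]/(r == i) (negbTE nr) /= /sxp.
  case: tpermP nr => [->|->|//]; first by rewrite eqxx.
  by rewrite val_nxt // => _; rewrite ltnn; lia.
apply/setP=> r; rewrite e e2.
case: (boolP (w q < w (sxp i r))%N) => wq; rewrite ?andbF ?andbT //.
apply/idP/idP => h.
  rewrite -[q]sK; apply: sxp_lt => // -[e3 e4].
  by case/eqP: nq; rewrite -[q]sK e4 sxp_r.
rewrite -[r]sK; apply: sxp_lt => // -[e3 e4].
by move: wq; rewrite e3 e4; lia.
Qed.

(* The monomial of the columns discarded when passing to [ortho_E0 (rothe w)]. *)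
Definition Om w : {mpoly int[n]} := \prod_c (if std (rothe w c) then xcol (rothe w c) else 1).

Lemma sy_xcol i C : (i \in C) = (nxt i \in C) -> msym (sxp i) (xcol C) = xcol C.
Proof.
move=> e; rewrite msymX; congr 'X_[_]; apply/mnmP=> r; rewrite !mnmE tpermV.
by congr nat_of_bool; rewrite /sxp; case: tpermP => [->|->|].
Qed.

(** At an ascent, a cell in row [i] has [c < w i < w (nxt i)], so the position of the value [c] is
    beyond [i.+1] and row [i.+1] has a cell too. *)
Lemma rothe_std_rows w i c : ascent w i -> std (rothe w c) ->
  (i \in rothe w c) = (nxt i \in rothe w c).
Proof.
case/ascentP=> hi lt /existsP[j /eqP e]; apply/idP/idP; last first.
  by rewrite e !in_initcol val_nxt //; lia.
rewrite !in_rothe => /andP[h1 h2]; have h3 : (c < w (nxt i))%N by lia.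
rewrite h3 andbT ltn_neqAle val_nxt // h1 andbT -(val_nxt hi).
by apply: contraTneq h3 => /val_inj ->; rewrite permKV ltnn.
Qed.

Lemma sy_Om w i : ascent w i -> msym (sxp i) (Om w) = Om w.
Proof.
move=> ai; rewrite rmorph_prod; apply: eq_bigr => c _.
by case: ifP => s; [apply: sy_xcol; apply: rothe_std_rows|exact: rmorph1].
Qed.

Lemma rswap0 i : rswap i set0 = set0.
Proof. by apply/setP=> r; rewrite !inE. Qed.

Lemma initcol_neq0 i : (set0 == initcol n i.+1) = false.
Proof. by apply/eqP=> /setP/(_ i); rewrite in_initcol inE ltnSn. Qed.

(** The swap fixes every other initial segment, so a nonstandard column can only become this one. *)
Lemma std_rswap i C : (i.+1 < n)%N -> ~~ std C -> std (rswap i C) = (rswap i C == initcol n i.+1).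
Proof.
move=> hi ns; apply/idP/eqP => [/existsP[j /eqP e]|->]; last by apply: std_initcol; apply: ltnW.
have [->//|ne] := eqVneq i.+1 (j : nat).
case/negP: ns; rewrite -[C](rswapK i) e rswap_initcol //; apply: std_initcol.
by rewrite -ltnS.
Qed.

Lemma initcolS i : initcol n i.+1 = i |: initcol n i.
Proof.
by apply/setP=> r; rewrite in_setU1 !in_initcol ltnS leq_eqVlt.
Qed.

Lemma xcolU1 i C : i \notin C -> xcol (i |: C) = 'X_i * xcol C.
Proof.
move=> ni; rewrite -mpolyXD; congr 'X_[_]; apply/mnmP=> r.
rewrite mnmDE mnm1E !mnmE in_setU1 [r == i]eq_sym.
by have [<-|] := eqVneq i r; rewrite ?(negbTE ni).
Qed.

Section AscentStep.
Variables (w : 'S_n) (i : 'I_n).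
Hypotheses (ai : ascent w i) (ci : rothe w (w i) = initcol n i).

Let hi : (i.+1 < n)%N. Proof. by case: (ascentP ai). Qed.

Let swi : rswap i (initcol n i) = initcol n i.
Proof. by apply: rswap_initcol => //; lia. Qed.

Let sti : std (initcol n i). Proof. exact/std_initcol/ltnW/ltn_ord. Qed.
Let sti1 : std (initcol n i.+1). Proof. exact/std_initcol/ltnW. Qed.

(** Column [w i] grows from [initcol n i] to [initcol n i.+1] and is discarded both times; the
    nonstandard columns undergo exactly the orthodontic step. *)
Lemma E0_ascent : ortho_E0 (rothe (sxp i * w)%g) = estep i (ortho_E0 (rothe w)).
Proof.
apply/ffunP=> c; rewrite [RHS]ffunE !E0E rothe_sxp //.
have [->|nc] := eqVneq c (w i).
  by rewrite ci swi -initcolS sti sti1 rswap0 initcol_neq0.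
case: (boolP (std (rothe w c))) => st.
  by rewrite rswap_inv ?st ?rswap0 ?initcol_neq0 //; apply: rothe_std_rows.
by rewrite std_rswap.
Qed.

(** The new cell contributes x_i, and each column that becomes standard contributes
    x_1...x_(i+1). *)
Lemma Om_ascent : Om (sxp i * w)%g =
  'X_i * (Om w * xcol (initcol n i.+1) ^+ mult i (ortho_E0 (rothe w))).
Proof.
have -> : 'X_i = \prod_c (if c == w i then 'X_i else 1) :> {mpoly int[n]}.
  by rewrite -big_mkcond big_pred1_eq.
rewrite /mult expr_sum /Om -!big_split /=; apply: eq_bigr => c _.
rewrite rothe_sxp // E0E.
have [->|nc] := eqVneq c (w i).
  rewrite ci swi -initcolS sti sti1 rswap0 initcol_neq0 expr0 mulr1 initcolS xcolU1 //.
  by rewrite in_initcol ltnn.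
case: (boolP (std (rothe w c))) => st.
  rewrite rswap_inv ?st ?rswap0 ?initcol_neq0 ?expr0 ?mulr1 ?mul1r //.
  exact: rothe_std_rows.
by rewrite std_rswap // mul1r mul1r; case: eqP => [->|].
Qed.

End AscentStep.

(** Descending from row [K] to [j], [w] stays above [w j], so every earlier position exceeds
    [w j]. *)
Lemma rothe_col_initial w (j : 'I_n) (K : nat) : (forall r, (r < K)%N -> (w j < w r)%N) ->
  (forall r, (K <= r)%N -> (r < j)%N -> ~~ ascent w r) -> rothe w (w j) = initcol n j.
Proof.
move=> hK desc; apply/setP=> r; rewrite in_rothe permK in_initcol.
case: (ltnP r j) => //= rj.
have [N] := ubnP (j - r)%N; elim: N r rj => // N IH r rj lN.
have [/hK //|Kr] := ltnP r K.
have hr : (r.+1 < n)%N by have := ltn_ord j; lia.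
have := desc r Kr rj; rewrite /ascent hr /= -leqNgt leq_eqVlt => /orP[|lt].
  by move/eqP/val_inj/perm_inj => e; have := nxt_neq hr; rewrite e eqxx.
have [e|ne] := eqVneq (nxt r) j; first by rewrite -e.
apply: leq_trans lt; apply: ltnW; apply: IH; rewrite val_nxt //; last by lia.
by move: ne; rewrite -val_eqE /= val_nxt //; lia.
Qed.

Lemma northwest_E0_rothe w : northwest (ortho_E0 (rothe w)).
Proof.
move=> c d r r' cd; rewrite !E0E; case: ifP; rewrite ?inE // => _.
case: ifP; rewrite ?inE // => _; rewrite !in_rothe; lia.
Qed.

End Schubert.

(** * The orthodontia formula *)

Section Orthodontia.
Variable n : nat.
Implicit Types (w : 'S_n) (i j r c d : 'I_n) (C : {set 'I_n}) (D : diagram n)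
  (f p q : {mpoly int[n]}).

Lemma sy_divdiff_far i j f : (i.+1 < n)%N -> (j.+1 < n)%N ->
  (i.+1 < j)%N || (j.+1 < i)%N ->
  msym (sxp j) f = f -> msym (sxp j) (divdiff i f) = divdiff i f.
Proof.
move=> hi hj far sf.
have comm : (sxp i * sxp j = sxp j * sxp i)%g.
  by case/orP: far => h; [|apply/esym]; apply: sxp_far.
have [e1 e2] : sxp j i = i /\ sxp j (nxt i) = nxt i.
  case/orP: far => [h|h].
    by have [? ? ? ?] := nxt_far hi hj h; rewrite /sxp !tpermD // eq_sym.
  by have [? ? ? ?] := nxt_far hj hi h; rewrite /sxp !tpermD // eq_sym.
have eX : msym (sxp j) ('X_i - 'X_(nxt i)) = 'X_i - 'X_(nxt i) :> {mpoly int[n]}.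
  by rewrite msymB !msymXi e1 e2.
apply/esym/divdiff_unique => //.
have := congr1 (msym (sxp j)) (divdiffE i f); rewrite msymM eX msymB sf => ->.
by rewrite -msymMm comm msymMm sf.
Qed.

Lemma lead_uniq D c c' : lead D c -> lead D c' -> c = c'.
Proof.
move=> [nz l] [nz' l']; case: (ltngtP c c') => [/l' e|/l e|/val_inj //].
  by rewrite e eqxx in nz.
by rewrite e eqxx in nz'.
Qed.

Lemma tooth_uniq C i i' : tooth C i -> tooth C i' -> i = i'.
Proof.
move=> [_ a b h] [_ a' b' h']; case: (ltngtP i i') => [/h' e|/h e|/val_inj //].
  by rewrite e in a.
by rewrite e in a'.
Qed.

Lemma sxp_fix i r : (i.+1 < n)%N -> (r < i)%N || (i.+1 < r)%N -> sxp i r = r.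
Proof.
by move=> hi h; rewrite /sxp tpermD // -val_eqE /= ?val_nxt //; lia.
Qed.

Lemma sy_xcol_initcol i (K : nat) : (i.+1 < n)%N -> i.+1 != K ->
  forall a, msym (sxp i) (xcol (initcol n K) ^+ a) = xcol (initcol n K) ^+ a.
Proof.
move=> hi iK a; rewrite rmorphXn; congr (_ ^+ _); apply: sy_xcol.
by rewrite !in_initcol val_nxt // [RHS]ltn_neqAle iK.
Qed.

(* If the tooth is [nxt j], the next one is [j], whence [dem_dem_sym]. *)
Lemma orth_sym D s p j : orth D s p -> northwest D -> (j.+1 < n)%N ->
  (forall c, j \notin D c /\ nxt j \notin D c) -> msym (sxp j) p = p.
Proof.
have [N] := ubnP (size s); elim: N D s p j => // N IH D s p j lN op nw hj emp.
have vj := val_nxt hj.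
case: op lN nw emp => {D s p} [D _ _ _ _|D c i s p l t op lN nw emp]; first exact: msym1.
have [hi ni ii mn] := t; have vi := val_nxt hi.
have ni1 : nxt i != j by apply: contraTneq ii => ->; case: (emp c).
have ni2 : i != j by apply: contraTneq ii => ->; case: (emp c).
have nw1 := northwest_estep nw l t.
have [e|ne] := eqVneq i (nxt j); last first.
  have far : (i.+1 < j)%N || (j.+1 < i)%N.
    by move: ni1 ni2 ne; rewrite -!val_eqE /= vi vj; lia.
  have sp : msym (sxp j) p = p.
    apply: (IH _ _ _ _ _ op) => //.
    move=> d; split; apply/negP=> /estepE[+ _]; rewrite sxp_fix ?vj //; try lia.
      by apply/negP; case: (emp d).
    by apply/negP; case: (emp d).
  apply: sy_divdiff_far => //; rewrite !msymM sp sy_xcol_initcol //; last by rewrite eqSS eq_sym.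
  by rewrite msymXi sxp_fix //; lia.
have vij : i = j.+1 :> nat by rewrite e.
have sij : sxp i j = j by rewrite sxp_fix // vij ltnSn.
(* Row [j] is empty, so no column becomes an initial segment reaching past it. *)
have nrm d : (rswap i (D d) == initcol n i.+1) = false.
  apply/eqP=> /setP/(_ j); rewrite inE sij in_initcol vij.
  by have [/negbTE -> _] := emp d; lia.
have E d : estep i D d = rswap i (D d) by rewrite ffunE nrm.
have -> : mult i D = 0%N by rewrite /mult big1 // => d _; rewrite nrm.
(* The cell below the tooth has moved up to row [nxt j] while row [j] is still empty, so the next
   tooth is [j], in the same column. *)
have jc : tooth (estep i D c) j.
  split=> //.
  - by rewrite E inE sij; case: (emp c).
  - by rewrite E inE -e sxp_l.
  - move=> r rj; have vr : nxt r = r.+1 :> nat by rewrite val_nxt //; have := ltn_ord j; lia.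
    rewrite E !inE !sxp_fix ?vr ?vij; try lia.
    by apply: mn; lia.
have lc : lead (estep i D) c.
  split; first by apply/set0Pn; exists (nxt j); case: jc.
  by move=> d /(proj2 l) ed; rewrite E ed rswap0.
rewrite expr0 mul1r.
case: op lN nw1 E jc lc => {p s} [D1 e1 _ _ _ _ [] /eqP/(_ (e1 c)) //|].
move=> D1 c' j' s p l' t' op lN nw1 E jc lc.
have ec := lead_uniq lc l'; subst c'; have ej := tooth_uniq jc t'; subst j'.
rewrite e; apply: dem_dem_sym; first by rewrite -vij.
have ik : i.+1 != j.+1 by rewrite vij; lia.
rewrite msymM -e (sy_xcol_initcol hi ik).
congr (_ * _); apply: (IH _ _ _ _ _ op) => //; first exact: ltnW.
  exact: northwest_estep l' t'.
move=> d; split; apply/negP=> /estepE[+ _]; rewrite E inE.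
  by rewrite {2}e sxp_r sij; apply/negP; case: (emp d).
rewrite [sxp j _]sxp_fix ?vi ?vij //; last by lia.
by rewrite sxp_r e; apply/negP; case: (emp d).
Qed.

Lemma estep_id i D : (forall c, i \notin D c /\ nxt i \notin D c) ->
  estep i D = D /\ mult i D = 0%N.
Proof.
move=> emp.
have E d : rswap i (D d) = D d.
  by apply: rswap_inv; have [/negbTE -> /negbTE ->] := emp d.
have nrm d : (D d == initcol n i.+1) = false.
  by apply/eqP=> /setP/(_ i); rewrite in_initcol ltnSn; have [/negbTE ->] := emp d.
split; first by apply/ffunP=> d; rewrite ffunE E nrm.
by rewrite /mult big1 // => d _; rewrite E nrm.
Qed.

(** The swap touches no nonstandard cell, so only [Om] changes, gaining x_i; everything else is
    symmetric under s_i, and ∂_i removes that factor. *)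
Lemma schubert_stay w i p D : ortho_E0 (rothe w) = D -> ascent w i ->
  rothe w (w i) = initcol n i -> (forall c, i \notin D c /\ nxt i \notin D c) ->
  msym (sxp i) p = p ->
  (ortho_E0 (rothe (sxp i * w)%g) = D -> schubert (sxp i * w)%g = Om (sxp i * w)%g * p) ->
  schubert w = Om w * p.
Proof.
move=> eD ai ci emp sp; have [hi _] := ascentP ai.
rewrite (E0_ascent ai ci) (Om_ascent ai ci) eD.
have [-> ->] := estep_id emp; rewrite expr0 mulr1 => /(_ erefl) e.
rewrite (schubert_ascent ai) e -mulrA divdiffXM_sym //.
by rewrite msymM sp sy_Om.
Qed.

Lemma sum_gt (r N : nat) : (\sum_(j < N) (r < j) = N.-1 - r)%N.
Proof.
elim: N => [|N IH]; first by rewrite big_ord0.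
by rewrite big_ord_recr /= IH; case: (ltnP r N); lia.
Qed.

Lemma Om_w0 w : (forall i, ~~ ascent w i) -> Om w = schub_w0 n.
Proof.
move=> na; rewrite /Om (reindex_inj (@perm_inj _ w)) /=.
have col j : rothe w (w j) = initcol n j by apply: (@rothe_col_initial _ _ _ 0).
rewrite (eq_bigr (fun j : 'I_n => \prod_(r < n) 'X_r ^+ (r < j)%N)); last first.
  move=> j _; rewrite col std_initcol; last exact/ltnW/ltn_ord.
  by rewrite /xcol mpolyXE_id; apply: eq_bigr => r _; rewrite mnmE in_initcol.
by rewrite exchange_big; apply: eq_bigr => r _; rewrite -expr_sum sum_gt.
Qed.

Lemma first_ascent w (K i : nat) :
  (forall r, (K <= r)%N -> (r < i)%N -> ~~ ascent w r) \/
  exists m : 'I_n, [/\ (K <= m < i)%N, ascent w m & forall r, (K <= r)%N -> (r < m)%N -> ~~ ascent w r].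
Proof.
pose P (r : 'I_n) := (K <= r < i)%N && ascent w r.
case: (pickP P) => [m0 Pm0|none]; last first.
  by left=> r Kr ri; have := none r; rewrite /P Kr ri /= => ->.
right; case: (arg_minnP (@nat_of_ord n) Pm0) => m /andP[Km am] mn; exists m; split=> // r Kr rm.
apply/negP=> ar; have := mn r; rewrite /P Kr ar andbT /=.
by move=> /(_ _); lia.
Qed.

(* Let the leftmost nonstandard column be full in rows [< K] and empty in rows
   [K..i], with tooth [i]. If [w] decreases on [K..i], then [w s_i] realises the
   orthodontic step. Otherwise, multiplying [w] by [s_m] for the first ascent [m]
   there leaves the nonstandard columns unchanged. *)
Theorem schubert_orth D s p w : orth D s p -> ortho_E0 (rothe w) = D -> schubert w = Om w * p.
Proof.
move=> op; elim: op w => {D s p} [D e|D c i s p l t op IH] w.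
  (* All columns are standard: multiply by first ascents until the longest element is reached. *)
  have [N] := ubnP (ninv w); elim: N w => // N IH w lN eD.
  case: (schubert_first w) => [[m [am mn _]]|na]; last first.
    by rewrite mulr1 schubert_none // Om_w0.
  apply: (schubert_stay eD am) => //; last 2 first.
  - exact: msym1.
  - by apply: IH; have := ninv_sxp am; lia.
  - by apply: (@rothe_col_initial _ _ _ 0) => // r _; apply: mn.
  - by move=> d; rewrite e !inE.
have [N] := ubnP (ninv w); elim: N w => // N IHN w lN eD.
have nw : northwest D by rewrite -eD; apply: northwest_E0_rothe.
have [K Ki hK] := tooth_initial t; have [hi ni ii _] := t; have vi := val_nxt hi.
have Dc : D c = rothe w c.
  by case: l => + _; rewrite -eD E0E; case: ifP => //; rewrite eqxx.
have := ii; rewrite Dc in_rothe vi => /andP[iq ci].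
(* All rows up to [i] precede the position of the value [c], so membership in column [c] just
   compares [w r] with [c]. *)
have lo r : (r < K)%N -> (c < w r)%N.
  by move=> rK; have := hK r; rewrite rK Dc in_rothe => /(_ _)/andP[|//]; lia.
have hi' r : (K <= r)%N -> (r <= i)%N -> (w r < c)%N.
  move=> Kr ri; have rK : (r < K)%N = false by lia.
  have := hK r ri; rewrite Dc in_rothe rK.
  have -> /= : (r < (w^-1)%g c)%N by lia.
  move/negbT; rewrite -leqNgt leq_eqVlt => /orP[/eqP/val_inj e|//].
  by move: iq; rewrite -e permK; lia.
have [desc|[m [/andP[Km mi] am mn]]] := first_ascent w K i.
  (* The value [c] separates [w i] from [w (nxt i)]. *)
  have ai : ascent w i by rewrite /ascent hi; have := hi' i Ki (leqnn _); lia.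
  have col : rothe w (w i) = initcol n i.
    by apply: rothe_col_initial desc => r /lo; have := hi' i Ki (leqnn _); lia.
  rewrite (schubert_ascent ai) (IH (sxp i * w)%g); last by rewrite E0_ascent // eD.
  rewrite Om_ascent // eD -!mulrA mulrCA.
  by rewrite divdiffMl // sy_Om.
have [hm _] := ascentP am; have vm := val_nxt hm.
(* Rows [m] and [m.+1] lie between [K] and [i], where the leading column has no cell, hence no
   column has one. *)
have emp d : m \notin D d /\ nxt m \notin D d.
  split; apply: (lead_row nw l _ ii); rewrite ?vi ?vm; try lia.
    by rewrite hK; lia.
  by rewrite hK vm; lia.
apply: (schubert_stay eD am) => //; last 2 first.
- exact: (orth_sym (orth_cons l t op)).
- by apply: IHN; have := ninv_sxp am; lia.
by apply: rothe_col_initial mn => r /lo; have := hi' m Km (ltnW mi); lia.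
Qed.

End Orthodontia.

Theorem theorem3p6 (n : nat) (w : 'S_n) :
  multiplicity_free w -> zero_one (schubert w).
Proof.
case=> fuel; case e: (ortho_run _ _) => [s Df] [ae mf].
have [p op] := ortho_run_orth e ae.
rewrite (schubert_orth op erefl).
have : zero_one p := orth_zero_one op (@northwest_E0_rothe _ w) mf.
rewrite /Om; elim/big_rec: _ => [|c x _ IH zp]; first by rewrite mul1r.
rewrite -mulrA; case: ifP => _; last by rewrite mul1r; apply: IH.
exact/zero_one_XM/IH.
Qed.
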